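(* Let $q$ be a power of two, $A$ a $q$-modular witness in a graph $G$, and write $\deg_A(v)\equiv d+qb_A(v)\pmod{2q}$ on $A$, where $d$ is a lift modulo $2q$ of the common residue modulo $q$ and $b_A(v)\in\{0,1\}$. Let $U\subseteq A$, $D=A\setminus U$, and suppose $D$ is partitioned into blocks $P_1,\dots,P_t$, each of size $q$, such that all vertices of $P_i$ have the same trace $B_i=N(x)\cap U$ on $U$. If $b_A|_U-\sum_{i=1}^t\mathbf 1_{B_i}$ is constant modulo $2$ on $U$, equivalently $[b_A|_U]=\sum_{i=1}^t[\mathbf 1_{B_i}]$ in $\mathbb F_2^U/\langle\mathbf 1_U\rangle$, then $U$ is $2q$-modular. In particular, if $|U|\le2q$, then $G[U]$ is regular.
   Context: Graphs are finite simple; $\deg_S(v)$ is the degree of $v$ in $G[S]$; $S$ is $q$-modular if all $\deg_S(v)$, $v\in S$, are congruent modulo $q$. $\mathbf 1_B$ is the indicator vector of $B$; the quotient is by constant vectors. *)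

(* Defs.v *)
From mathcomp Require Import all_boot all_order all_algebra.
From mathcomp Require Import ring_quotient.

Set Implicit Arguments.
Unset Strict Implicit.
Unset Printing Implicit Defensive.

Definition nbr (T : finType) (e : rel T) (x : T) : {set T} := [set y | e x y].

Definition deg_in (T : finType) (e : rel T) (S : {set T}) (v : T) : nat :=
  #|nbr e v :&: S|.

Definition modular (T : finType) (e : rel T) (q : nat) (S : {set T}) : Prop :=
  {in S &, forall u v, deg_in e S u = deg_in e S v %[mod q]}.

Definition induces_regular (T : finType) (e : rel T) (S : {set T}) : Prop :=
  exists r : nat, {in S, forall v, deg_in e S v = r}.

(* The space F_2^U; the coefficients are [('F_2)^o] because the [vectType]
   structure on finite functions needs a [vectType] codomain. *)
Definition F2vec (T : finType) (U : {set T}) :=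
  {ffun {x : T | x \in U} -> ('F_2)^o}%R.

Definition restr2 (T : finType) (U : {set T}) (f : T -> bool) : F2vec U :=
  [ffun u : {x : T | x \in U} => ((f (val u))%:R : ('F_2)^o)%R].

Definition indic2 (T : finType) (U B : {set T}) : F2vec U :=
  restr2 U (fun x => x \in B).

(* F_2^U / <1_U>, as a quotient additive group. *)
Definition F2quot (T : finType) (U : {set T}) :=
  Quotient.quot (pred_of_vspace <[indic2 U U]>%VS).

Definition cls (T : finType) (U : {set T}) (f : F2vec U) : F2quot U :=
  (\pi_(F2quot U) f)%qT.

Definition constant_vec (T : finType) (U : {set T}) (f : F2vec U) : Prop :=
  exists c : 'F_2, forall u, f u = c.

(* Main.v *)
(** For [v] in [U], the block [P i] contributes to the degree of [v] in [A]
    either all of its [q] vertices, when [v] is in [B i], or none of them.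
    Hence [deg_A v = deg_U v + q n(v)], where [n(v)] counts the traces
    containing [v], and modulo [2q] the degree [deg_U v] is [d + q (b v - n(v))],
    which depends only on the parity of [b v - n(v)]. *)

Require Import Defs.
From mathcomp Require Import all_boot all_order all_algebra.
From mathcomp Require Import ring_quotient.

Import GRing.Theory.

Lemma clsD (T : finType) (U : {set T}) :
  {morph @cls T U : f g / (f + g)%R >-> (f + g)%R}.
Proof. by move=> f g; rewrite /cls !piE. Qed.

Lemma cls_sum (T : finType) (U : {set T}) (I : Type) (r : seq I)
    (F : I -> F2vec U) :
  cls (\sum_(i <- r) F i)%R = (\sum_(i <- r) cls (F i))%R.
Proof.
elim: r => [|i r IHr]; first by rewrite !big_nil /cls !piE.
by rewrite !big_cons clsD IHr.
Qed.

(** [indic2 U U] is the all-ones vector of [F2vec U], so its scalar multiples are exactly the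
    constant vectors. This turns equality in the quotient into a statement about values. *)
Lemma constant_vecP (T : finType) (U : {set T}) (f : F2vec U) :
  constant_vec f <-> f \in <[indic2 U U]>%VS.
Proof.
have oneE u : indic2 U U u = 1%R by rewrite !ffunE (valP u).
split=> [[c fc]|/vlineP[c ->]].
  apply/vlineP; exists c; apply/ffunP => u; rewrite fc ffunE oneE.
  exact/esym/mulr1.
by exists c => u; rewrite ffunE oneE; apply: mulr1.
Qed.

Lemma eq_cls (T : finType) (U : {set T}) (f g : F2vec U) :
  cls f = cls g <-> constant_vec (f - g)%R.
Proof.
apply: iff_trans (iff_sym (constant_vecP _ _ _)); rewrite Quotient.idealrBE.
by split=> [fg|/eqP//]; apply/eqP.
Qed.

Lemma natr_F2_eq (m n : nat) : (m%:R = n%:R :> 'F_2)%R -> m = n %[mod 2].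
Proof. by move/(congr1 val); rewrite /= !val_Fp_nat. Qed.

Lemma deg_in_lt_card (T : finType) (e : rel T) (S : {set T}) (v : T) :
  irreflexive e -> v \in S -> deg_in e S v < #|S|.
Proof.
move=> e_irr vS; apply: proper_card; apply/properP; split; first exact: subsetIr.
by exists v; rewrite // !inE e_irr.
Qed.

Lemma deg_in_setID (T : finType) (e : rel T) (A U : {set T}) (v : T) :
  U \subset A -> deg_in e A v = deg_in e U v + deg_in e (A :\: U) v.
Proof.
move=> UA; rewrite /deg_in -(cardsID U (nbr e v :&: A)) -setIA (setIidPr UA).
by rewrite setIDA.
Qed.

(** Counting neighbours as a sum of ones lets the sum split over the set of blocks; injectivity of
    [P] then reindexes it by ['I_t] without merging equal blocks. *)
Lemma deg_in_partition (T : finType) (e : rel T) (t : nat)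
    (P : 'I_t -> {set T}) (D : {set T}) (v : T) :
  injective P -> partition [set P i | i : 'I_t] D ->
  deg_in e D v = \sum_(i < t) deg_in e (P i) v.
Proof.
move=> P_inj P_part.
have degE S : deg_in e S v = \sum_(x in S | e v x) 1.
  by rewrite sum1dep_card; apply: eq_card => x; rewrite !inE andbC.
rewrite degE (set_partition_big_cond _ P_part) big_imset /=.
  by apply: eq_bigr => i _; rewrite degE.
by move=> i j _ _; apply: P_inj.
Qed.

Lemma deg_in_same_trace (T : finType) (e : rel T) (U P B : {set T}) (v : T) :
  symmetric e -> {in P, forall x, nbr e x :&: U = B} -> v \in U ->
  deg_in e P v = #|P| * (v \in B).
Proof.
move=> e_sym PB vU.
have adjE x : x \in P -> e v x = (v \in B).
  by move=> xP; rewrite -(PB x xP) !inE vU andbT e_sym.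
rewrite /deg_in; case: (v \in B) adjE => adjE; rewrite ?muln1 ?muln0.
  by congr #|pred_of_set _|; apply/setIidPr/subsetP => x xP; rewrite inE adjE.
apply/eqP; rewrite cards_eq0; apply/eqP/setP => x; rewrite !inE.
by case: (boolP (x \in P)) => [/adjE->|]; rewrite ?andbF.
Qed.

(** Without loops, degrees inside [S] are below [#|S|], hence below [m], so they equal their own
    residues. *)
Lemma modular_small_regular (T : finType) (e : rel T) (m : nat) (S : {set T}) :
  irreflexive e -> modular e m S -> #|S| <= m -> induces_regular e S.
Proof.
move=> e_irr S_mod Sm; have [->|[u uS]] := set_0Vmem S.
  by exists 0 => v; rewrite inE.
exists (deg_in e S u) => v vS; have := S_mod v u vS uS.
by rewrite !modn_small // (leq_trans _ Sm) // deg_in_lt_card.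
Qed.

Theorem mainTheorem14
    (T : finType) (e : rel T) (e_sym : symmetric e) (e_irr : irreflexive e)
    (k q : nat) (q_pow2 : q = 2 ^ k)
    (A : {set T}) (A_mod : modular e q A)
    (d : nat) (b : T -> bool)
    (b_deg : {in A, forall v, deg_in e A v = d + q * b v %[mod 2 * q]})
    (U : {set T}) (UA : U \subset A)
    (t : nat) (P B : 'I_t -> {set T})
    (P_inj : injective P)
    (P_part : partition [set P i | i : 'I_t] (A :\: U))
    (P_card : forall i, #|P i| = q)
    (P_trace : forall i, {in P i, forall x, nbr e x :&: U = B i}) :
  (constant_vec (restr2 U b - \sum_(i < t) indic2 U (B i))%R <->
     cls (restr2 U b) = (\sum_(i < t) cls (indic2 U (B i)))%R) /\
  (constant_vec (restr2 U b - \sum_(i < t) indic2 U (B i))%R ->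
     modular e (2 * q) U /\ (#|U| <= 2 * q -> induces_regular e U)).
Proof.
split; first by rewrite -cls_sum; apply: iff_sym; apply: eq_cls.
case=> c const_c.
have modU : modular e (2 * q) U; last by split=> //; apply: modular_small_regular.
pose n v := \sum_(i < t) (v \in B i).
have degE v : v \in U -> deg_in e U v + q * n v = d + q * b v %[mod 2 * q].
  move=> vU; rewrite -b_deg ?(subsetP UA) // (deg_in_setID _ _ _ _ _ UA).
  rewrite (deg_in_partition _ _ _ _ _ _ P_inj P_part) big_distrr /=.
  congr ((_ + _) %% _); apply: eq_bigr => i _.
  by rewrite (deg_in_same_trace _ _ _ _ _ _ e_sym (P_trace i) vU) P_card.
have bE v : v \in U -> ((b v)%:R = (n v)%:R + c :> 'F_2)%R.
  (* The constant [c] is replaced by the value at [v] of the difference vector. *)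
  move=> vU; rewrite -(const_c (Sub v vU)) !ffunE sum_ffunE /= natr_sum.
  rewrite [X in (_ + (_ - X))%R](_ : _ = \sum_(i < t) (v \in B i)%:R)%R.
    by rewrite addrC subrK.
  by apply: eq_bigr => i _; rewrite ffunE.
move=> u v uU vU; apply/eqP.
(* By [bE], both bracketed sums equal [n u + n v + c] in ['F_2]; crossing [u] and [v] avoids
   subtraction in [nat]. Multiplying by [q] lifts the congruence from modulus 2 to [2 * q]. *)
have parity : q * (n u + b v) = q * (n v + b u) %[mod 2 * q].
  rewrite (mulnC 2) -!muln_modr; congr (q * _); apply: natr_F2_eq.
  by rewrite !natrD !bE // addrCA addrA.
(* Congruent amounts are added to the two degrees: [q * (n u + b v)] on the left, [q * (n v + b u)]
   on the right. By [degE], both sides become [d + q * b u + q * b v]. *)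
rewrite -(eqn_modDr (q * (n u + b v))) -[X in _ == X]modnDmr parity modnDmr.
rewrite !mulnDr !addnA -modnDml degE // modnDml.
by rewrite -[X in _ == X]modnDml degE // modnDml addnAC.
Qed.
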